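(* Let $\alpha_2\in\mathbb{C}$ and consider a system of first-order ordinary differential equations $$\frac{dx}{dt}=f_1,\ \frac{dy}{dt}=f_2,\ \frac{dz}{dt}=f_3,\ \frac{dw}{dt}=f_4,\ \frac{dq}{dt}=f_5,\qquad f_i\in\mathbb{C}(t)[x,y,z,w,q]\ (i=1,\dots,5).$$ Assume: (A1) $\deg f_i=2$ with respect to $x,y,z,w,q$; (A2) in each of the following coordinate systems $r_i:(x_i,y_i,z_i,w_i,q_i)$, $i=1,2,3$, the transformed system has right-hand sides that are polynomials in $x_i,y_i,z_i,w_i,q_i$: $$r_1:\ (x_1,y_1,z_1,w_1,q_1)=\left(x,\,y,\,z,\,-\left(wq+\tfrac12(2\alpha_2-1)\right)q,\,\tfrac1q\right),$$ $$r_2:\ (x_2,y_2,z_2,w_2,q_2)=\left(x+\tfrac q2,\,y+\tfrac{q^2}{4},\,z-\tfrac14q(q^2+8y),\,-\left(\left(w+\tfrac t2-4y^2+q(yq-2z)\right)q-\tfrac12-\alpha_2\right)q,\,\tfrac1q\right),$$ $$r_3:\ x_3=\frac1x,\quad y_3=\frac yx+x,\quad w_3=\frac w{x^2},\quad q_3=qx^2+\frac34x(x^2-2y)+\frac{w-y^2}{4x},$$ $$z_3=-x^3z-\frac1{64}y(4t+5w-35y^2)-\frac1{16}x(4wq+2\alpha_2+1)+\frac{3y(y^2-w)^2}{128x^4}-\frac{105}{128}x^4y-\frac7{128}x^6-\frac3{64}x^2(4t+15w-35y^2)+\frac{(w-21y^2)(w-y^2)}{128x^2}.$$ Then the system coincides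 with $$\frac{dx}{dt}=y+g(t)\ (g(t)\in\mathbb{C}(t)),\quad \frac{dy}{dt}=z,\quad \frac{dz}{dt}=-6y^2+w+\frac t4,\quad \frac{dw}{dt}=wq+\frac{2\alpha_2-1}{4},\quad \frac{dq}{dt}=-\frac12q^2-4y .$$ *)

(* Defs.v *)
From HB Require Import structures.
From mathcomp Require Import all_boot all_algebra.
From mathcomp.real_closed Require Import complex.
From mathcomp Require Import Rstruct.
From mathcomp Require Import mpoly.

Set Implicit Arguments.
Unset Strict Implicit.
Unset Printing Implicit Defensive.

Import GRing.Theory.
Local Open Scope ring_scope.

Local Notation "x %:F" := (@FracField.tofrac _ x).

Definition C : Type := complex Rdefinitions.R.
Definition K := {fraction {poly C}}.
(* polynomial ring K[x,y,z,w,q] : variables 'X_0 = x, 'X_1 = y, 'X_2 = z, 'X_3 = w, 'X_4 = q *)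
Definition MP := {mpoly K[5]}.
Definition L := {fraction MP}.

(* for u = n/d (any representative), du/dt = (n' d - n d') / d^2 *)
Definition derK (u : K) : K :=
  let r := repr u in
  ((\n_r)^`() * \d_r - \n_r * (\d_r)^`())%:F / ((\d_r) ^+ 2)%:F.

Definition tK : K := ('X)%:F.
Definition cK (a : C) : K := (a%:P)%:F.

(* the system dx/dt = f_0, dy/dt = f_1, dz/dt = f_2, dw/dt = f_3, dq/dt = f_4
   with f : 'I_5 -> K[x,y,z,w,q] defines the derivation d/dt on K[x,y,z,w,q]:
   dP/dt = (coefficientwise d/dt of P) + sum_i (dP/dX_i) f_i *)
Definition mpD (f : 'I_5 -> MP) (P : MP) : MP :=
  map_mpoly derK P + \sum_(i < 5) P^`M(i) * f i.

Definition derL (f : 'I_5 -> MP) (u : L) : L :=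
  let r := repr u in
  (mpD f (\n_r) * \d_r - \n_r * mpD f (\d_r))%:F / ((\d_r) ^+ 2)%:F.

Definition var (k : nat) : MP := 'X_(inord k).
Definition varL (k : nat) : L := (var k)%:F.
Definition cL (c : K) : L := (c%:MP)%:F.

Definition vec5 (a b c d e : L) : 'I_5 -> L :=
  fun i => nth 0 [:: a; b; c; d; e] i.

Definition evalL (P : MP) (u : 'I_5 -> L) : L := mmap cL u P.

Definition polynomial_in_coords (f : 'I_5 -> MP) (u : 'I_5 -> L) : Prop :=
  forall j : 'I_5, exists P : MP, derL f (u j) = evalL P u.

Section Coords.
Variable alpha2 : C.
Let x := varL 0. Let y := varL 1. Let z := varL 2. Let w := varL 3. Let q := varL 4.
Let t := cL tK.
Let a := cL (cK alpha2).
Let n (k : nat) : L := k%:R.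

Definition r1 : 'I_5 -> L :=
  vec5 x y z (- (w * q + (n 2)^-1 * (n 2 * a - 1)) * q) q^-1.

Definition r2 : 'I_5 -> L :=
  vec5 (x + q / n 2) (y + q ^+ 2 / n 4) (z - (n 4)^-1 * q * (q ^+ 2 + n 8 * y))
       (- ((w + t / n 2 - n 4 * y ^+ 2 + q * (y * q - n 2 * z)) * q - (n 2)^-1 - a) * q)
       q^-1.

Definition z3 : L :=
  - x ^+ 3 * z
  - (n 64)^-1 * y * (n 4 * t + n 5 * w - n 35 * y ^+ 2)
  - (n 16)^-1 * x * (n 4 * w * q + n 2 * a + 1)
  + n 3 * y * (y ^+ 2 - w) ^+ 2 / (n 128 * x ^+ 4)
  - n 105 / n 128 * x ^+ 4 * y
  - n 7 / n 128 * x ^+ 6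
  - n 3 / n 64 * x ^+ 2 * (n 4 * t + n 15 * w - n 35 * y ^+ 2)
  + (w - n 21 * y ^+ 2) * (w - y ^+ 2) / (n 128 * x ^+ 2).

Definition r3 : 'I_5 -> L :=
  vec5 x^-1 (y / x + x) z3 (w / x ^+ 2)
       (q * x ^+ 2 + n 3 / n 4 * x * (x ^+ 2 - n 2 * y) + (w - y ^+ 2) / (n 4 * x)).
End Coords.

(* Main.v *)
Require Import Defs.
From HB Require Import structures.
From mathcomp Require Import all_boot all_algebra.
From mathcomp.real_closed Require Import complex.
From mathcomp Require Import Rstruct.
From mathcomp Require Import mpoly.
From mathcomp Require Import ring.
Import GRing.Theory.
Local Open Scope ring_scope.

(* On the curve w_i = 0 of the chart r_i (i = 1, 2), the other coordinates x_i, y_i, z_i being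
   fixed, x, y, z, w, q are Laurent polynomials in s = 1/q.  If the derivatives of the chart
   coordinates are polynomials in these coordinates, they have no pole at s = 0 along the
   curve.  This condition is affine in the system, and the system of the conclusion satisfies
   it, so the difference of the two is a quadratic vector field satisfying the associated
   linear condition.  Such a vector field is a constant multiple of d/dx.  As both charts
   commute with the translations of x, it is enough, by taking finite differences in x, to
   consider the fields that do not depend on x, up to a multiple of x in their first
   component.  For these, the polar parts at s = 0 determine successively the q-, x-, y-, z-
   and w-components. *)

Set Implicit Arguments.
Unset Strict Implicit.
Unset Printing Implicit Defensive.

Local Notation "x %:F" := (@FracField.tofrac _ x).

(** * Derivations *)

Definition derivation (R : nzRingType) (D : R -> R) : Prop :=
  {morph D : u v / u + v} /\ (forall u v, D (u * v) = D u * v + u * D v).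

Section DerivationTheory.
Variables (R : nzRingType) (D : R -> R).
Hypothesis derD : derivation D.

Lemma derivationD u v : D (u + v) = D u + D v. Proof. by case: derD. Qed.

Lemma derivationM u v : D (u * v) = D u * v + u * D v. Proof. by case: derD. Qed.

Lemma derivation0 : D 0 = 0.
Proof. by apply: (addrI (D 0)); rewrite -derivationD !addr0. Qed.

Lemma derivation1 : D 1 = 0.
Proof. by apply: (addrI (D 1)); rewrite -{3}[1]mulr1 derivationM mulr1 mul1r addr0. Qed.

Lemma derivationN u : D (- u) = - D u.
Proof. by apply/eqP; rewrite -addr_eq0 -derivationD addNr derivation0. Qed.

Lemma derivationB u v : D (u - v) = D u - D v.
Proof. by rewrite derivationD derivationN. Qed.

Lemma derivation_nat n : D n%:R = 0.
Proof.
elim: n => [|n IHn]; first exact: derivation0.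
by rewrite -natr1 derivationD IHn derivation1 addr0.
Qed.

End DerivationTheory.

Lemma derivationV (E : fieldType) (D : E -> E) u :
  derivation D -> u != 0 -> D u^-1 = - D u / u ^+ 2.
Proof.
move=> derD u0; have := derivation1 derD.
rewrite -(divff u0) derivationM // => /eqP; rewrite addrC addr_eq0 => /eqP DV.
by apply: (mulfI u0); rewrite DV; field.
Qed.

Section QuotientRules.
Variables (E : fieldType) (a a' b b' c c' d d' : E).
Hypotheses (b0 : b != 0) (d0 : d != 0).

Lemma quotient_ruleD :
  ((a' * d + a * d' + (c' * b + c * b')) * (b * d) -
   (a * d + c * b) * (b' * d + b * d')) / (b * d) ^+ 2 =
  (a' * b - a * b') / b ^+ 2 + (c' * d - c * d') / d ^+ 2.
Proof. by field; rewrite b0 d0. Qed.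

Lemma quotient_ruleM :
  ((a' * c + a * c') * (b * d) - a * c * (b' * d + b * d')) / (b * d) ^+ 2 =
  (a' * b - a * b') / b ^+ 2 * (c / d) + a / b * ((c' * d - c * d') / d ^+ 2).
Proof. by field; rewrite b0 d0. Qed.

End QuotientRules.

Section FractionDerivation.
Variables (R : idomainType) (D : R -> R).
Hypothesis derD : derivation D.

(* [derK] is [fderiv (@deriv C)] and [derL f] is [fderiv (mpD f)]. *)
Definition fderiv (u : {fraction R}) : {fraction R} :=
  let r := repr u in
  (D \n_r * \d_r - \n_r * D \d_r)%:F / (\d_r ^+ 2)%:F.

Lemma fraction_repr (u : {fraction R}) : u = (\n_(repr u))%:F / (\d_(repr u))%:F.
Proof.
have d0 := denom_ratioP (repr u).
apply: (canRL (mulfK _)); first by rewrite tofrac_eq0.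
rewrite -[X in X * _ = _]reprK; unlock FracField.tofrac.
rewrite -[LHS]FracField.pi_mul; apply/eqmodP; rewrite /= FracField.equivfE.
by rewrite /FracField.mulf !numden_Ratio ?oner_eq0 ?mulr1 // mulrC.
Qed.

Lemma fraction_eq (n d n' d' : R) : d != 0 -> d' != 0 ->
  n%:F / d%:F = n'%:F / d'%:F -> n * d' = n' * d.
Proof.
move=> d0 d'0 /eqP; rewrite eqr_div ?tofrac_eq0 //.
by rewrite -!tofracM tofrac_eq => /eqP.
Qed.

Lemma fderiv_div (n d : R) : d != 0 ->
  fderiv (n%:F / d%:F) = (D n * d - n * D d)%:F / (d ^+ 2)%:F.
Proof.
move=> d0; rewrite /fderiv; set u := n%:F / d%:F.
have r0 := denom_ratioP (repr u).
have e : n * \d_(repr u) = \n_(repr u) * d.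
  exact: (fraction_eq d0 r0 (fraction_repr u)).
move: (\n_(repr u)) (\d_(repr u)) r0 e => m c c0 e.
have De : D m * d = D n * c + n * D c - m * D d.
  by apply: (canRL (addrK _)); rewrite -!derivationM // e.
apply/eqP; rewrite eqr_div ?tofrac_eq0 ?expf_neq0 // -!tofracM tofrac_eq; apply/eqP.
transitivity (c * d * (D m * d) - (m * d) * d * D c); first by ring.
by rewrite De -e; ring: e.
Qed.

Lemma fderiv_tofrac (n : R) : fderiv n%:F = (D n)%:F.
Proof.
rewrite -[n%:F]divr1 -tofrac1 fderiv_div ?oner_eq0 // (derivation1 derD).
by rewrite expr1n !mulr1 mulr0 subr0 tofrac1 divr1.
Qed.

Lemma fderiv_derivation : derivation fderiv.
Proof.
split=> u v; rewrite [u]fraction_repr [v]fraction_repr;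
  have := denom_ratioP (repr u); have := denom_ratioP (repr v);
  move: (\n_(repr u)) (\d_(repr u)) (\n_(repr v)) (\d_(repr v)) => a b c d d0 b0.
- rewrite addf_div ?tofrac_eq0 // -!tofracM -tofracD !fderiv_div ?mulf_neq0 //.
  rewrite (derivationD derD) !(derivationM derD) !(tofracXn, tofracB, tofracM, tofracD).
  by apply: quotient_ruleD; rewrite tofrac_eq0.
- rewrite mulf_div -!tofracM !fderiv_div ?mulf_neq0 // !(derivationM derD).
  rewrite !(tofracXn, tofracB, tofracM, tofracD).
  by apply: quotient_ruleM; rewrite tofrac_eq0.
Qed.

End FractionDerivation.

Section CoefficientDerivation.
Variables (n : nat) (R : comNzRingType) (D : {additive R -> R}).
Hypothesis derD : derivation D.
Implicit Types (P Q : {mpoly R[n]}) (m : 'X_{1..n}).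

Lemma map_mpoly_monomial c m : map_mpoly D (c *: 'X_[m]) = D c *: 'X_[m].
Proof.
apply/mpolyP => k; rewrite mcoeff_map_mpoly !mcoeffZ !mcoeffX.
by rewrite !mulr_natr raddfMn.
Qed.

Lemma map_mpoly_derivation : derivation (map_mpoly D : {mpoly R[n]} -> {mpoly R[n]}).
Proof.
split=> P Q; first exact: raddfD.
elim/mpolyind: P => [|c m P _ _ IHP]; first by rewrite mul0r raddf0 !mul0r add0r.
rewrite mulrDl !raddfD /= IHP map_mpoly_monomial.
suff -> : map_mpoly D (c *: 'X_[m] * Q) =
  D c *: 'X_[m] * Q + c *: 'X_[m] * map_mpoly D Q by rewrite !mulrDl addrACA.
elim/mpolyind: Q {IHP} => [|c' m' Q _ _ IHQ]; first by rewrite mulr0 raddf0 !mulr0 addr0.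
rewrite mulrDr !raddfD /= IHQ map_mpoly_monomial !mulrDr addrACA; congr (_ + _).
rewrite -!scalerAl -!scalerAr !scalerA -mpolyXD map_mpoly_monomial (derivationM derD).
by rewrite scalerDl.
Qed.

Variable f : 'I_n -> {mpoly R[n]}.

Definition vector_field P : {mpoly R[n]} := map_mpoly D P + \sum_(i < n) P^`M(i) * f i.

Lemma vector_field_derivation : derivation vector_field.
Proof.
rewrite /vector_field; split=> P Q.
  rewrite (derivationD map_mpoly_derivation) addrACA -big_split; congr (_ + _).
  by apply: eq_bigr => i _ /=; rewrite mderivD mulrDl.
rewrite (derivationM map_mpoly_derivation) mulrDl mulrDr addrACA; congr (_ + _).
rewrite mulr_suml mulr_sumr -big_split; apply: eq_bigr => i _ /=.
by rewrite mderivM mulrDl mulrA; congr (_ + _); exact: mulrAC.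
Qed.

Lemma vector_fieldC c : vector_field c%:MP = (D c)%:MP.
Proof.
rewrite /vector_field map_mpolyC big1 ?addr0 // => i _.
by rewrite mderivC mul0r.
Qed.

Lemma vector_fieldX i : vector_field 'X_i = f i.
Proof.
have DX : map_mpoly D 'X_i = 0.
  by have := map_mpoly_monomial 1 U_(i); rewrite scale1r (derivation1 derD) scale0r.
rewrite /vector_field DX add0r (bigD1 i) //= big1 => [|j ne_ji].
  rewrite addr0 mderivX mnm1E eqxx scale1r -[RHS]mul1r -mpolyX0; congr ('X_[_] * _).
  by apply/mnmP => k; rewrite mnmBE subnn mnm0E.
by rewrite mderivX mnm1E eq_sym (negbTE ne_ji) scale0r mul0r.
Qed.

End CoefficientDerivation.

(** * Values of rational functions *)

Section Specialization.
Variables (R : idomainType) (E : fieldType) (phi : {rmorphism R -> E}).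
Implicit Types u : {fraction R}.

(* [phi] extends to the fractions whose denominator it does not kill. *)
Definition specializes u (e : E) : Prop :=
  exists n d : R, [/\ phi d != 0, u = n%:F / d%:F & e = phi n / phi d].

Lemma neq0_rmorph d : phi d != 0 -> d != 0.
Proof. by apply: contraNneq => ->; rewrite rmorph0. Qed.

Lemma specializes_tofrac n : specializes n%:F (phi n).
Proof. by exists n, 1; rewrite rmorph1 oner_neq0 tofrac1 !divr1. Qed.

Lemma specializes1 : specializes 1 1.
Proof. by have := specializes_tofrac 1; rewrite tofrac1 rmorph1. Qed.

Lemma specializes0 : specializes 0 0.
Proof. by have := specializes_tofrac 0; rewrite tofrac0 rmorph0. Qed.

Lemma specializesD u u' e e' :
  specializes u e -> specializes u' e' -> specializes (u + u') (e + e').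
Proof.
move=> [n [d [d0 -> ->]]] [n' [d' [d'0 -> ->]]].
exists (n * d' + n' * d), (d * d'); rewrite rmorphM mulf_neq0 //; split=> //.
  by rewrite addf_div ?tofrac_eq0 ?neq0_rmorph // -!tofracM -tofracD.
by rewrite addf_div // rmorphD !rmorphM.
Qed.

Lemma specializesM u u' e e' :
  specializes u e -> specializes u' e' -> specializes (u * u') (e * e').
Proof.
move=> [n [d [d0 -> ->]]] [n' [d' [d'0 -> ->]]].
exists (n * n'), (d * d'); rewrite rmorphM mulf_neq0 // !mulf_div.
by rewrite !tofracM rmorphM.
Qed.

Lemma specializesN u e : specializes u e -> specializes (- u) (- e).
Proof.
move=> [n [d [d0 -> ->]]]; exists (- n), d; split=> //.
  by rewrite tofracN mulNr.
by rewrite rmorphN mulNr.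
Qed.

Lemma specializesV u e : e != 0 -> specializes u e -> specializes u^-1 e^-1.
Proof.
move=> e0 [n [d [d0 -> eE]]]; move: e0; rewrite eE mulf_eq0 invr_eq0 (negbTE d0) orbF => n0.
by exists d, n; rewrite !invf_div.
Qed.

Lemma specializesX u e k : specializes u e -> specializes (u ^+ k) (e ^+ k).
Proof.
move=> ue; elim: k => [|k IHk]; first exact: specializes1.
by rewrite !exprS; exact: specializesM.
Qed.

Lemma specializes_sum (I : Type) (r : seq I) (u : I -> {fraction R}) (e : I -> E) :
  (forall i, specializes (u i) (e i)) ->
  specializes (\sum_(i <- r) u i) (\sum_(i <- r) e i).
Proof.
move=> ue; elim/big_rec2: _ => [|i y z _ IH]; first exact: specializes0.
exact: specializesD.
Qed.

Lemma specializes_prod (I : Type) (r : seq I) (u : I -> {fraction R}) (e : I -> E) :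
  (forall i, specializes (u i) (e i)) ->
  specializes (\prod_(i <- r) u i) (\prod_(i <- r) e i).
Proof.
move=> ue; elim/big_rec2: _ => [|i y z _ IH]; first exact: specializes1.
exact: specializesM.
Qed.

Lemma specializes_inj u e e' : specializes u e -> specializes u e' -> e = e'.
Proof.
move=> [n [d [d0 -> ->]]] [n' [d' [d'0 eq_u ->]]].
have /(congr1 phi) := fraction_eq (neq0_rmorph d0) (neq0_rmorph d'0) eq_u.
by rewrite !rmorphM => eq_phi; apply/eqP; rewrite eqr_div // eq_phi.
Qed.

End Specialization.

Lemma specializes_mmap n (E : fieldType) (v : 'I_n -> E) (P : {mpoly E[n]})
    (u : 'I_n -> {fraction {mpoly E[n]}}) (e : 'I_n -> E) :
  (forall i, specializes (meval v) (u i) (e i)) ->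
  specializes (meval v) (mmap (fun c => (c%:MP)%:F) u P) P.@[e].
Proof.
move=> ue; apply: specializes_sum => m; apply: specializesM.
  by rewrite -{2}[P@_m](mevalC v); exact: specializes_tofrac.
by apply: specializes_prod => i; exact: specializesX.
Qed.

Section Jets.
Variables (R : idomainType) (E : fieldType) (phi : {rmorphism R -> E}).
Variable D : {fraction R} -> {fraction R}.
Hypothesis derD : derivation D.
Implicit Types u : {fraction R}.

Definition jet u (e e' : E) : Prop := specializes phi u e /\ specializes phi (D u) e'.

Lemma jet_eq u e e' e1 e1' : jet u e e' -> e = e1 -> e' = e1' -> jet u e1 e1'.
Proof. by move=> + <- <-. Qed.

Lemma jetD u u' e e' e1 e1' : jet u e e1 -> jet u' e' e1' ->
  jet (u + u') (e + e') (e1 + e1').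
Proof.
by case=> [? ?] [? ?]; split; rewrite ?(derivationD derD); exact: specializesD.
Qed.

Lemma jetM u u' e e' e1 e1' : jet u e e1 -> jet u' e' e1' ->
  jet (u * u') (e * e') (e1 * e' + e * e1').
Proof.
case=> [ue u1] [ue' u1']; split; rewrite ?(derivationM derD); first exact: specializesM.
by apply: specializesD; exact: specializesM.
Qed.

Lemma jetN u e e1 : jet u e e1 -> jet (- u) (- e) (- e1).
Proof. by case=> [? ?]; split; rewrite ?(derivationN derD); exact: specializesN. Qed.

Lemma jetV u e e1 : e != 0 -> jet u e e1 -> jet u^-1 e^-1 (- e1 / e ^+ 2).
Proof.
move=> e0 [ue u1]; split; first exact: specializesV.
have u0 : u != 0.
  apply: contraNneq e0 => u0; rewrite u0 in ue.
  by rewrite (specializes_inj ue (specializes0 phi)).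
rewrite (derivationV derD u0); apply: specializesM; first exact: specializesN.
by apply: specializesV; [rewrite expf_neq0 | exact: specializesX].
Qed.

Lemma jet_nat k : jet k%:R k%:R 0.
Proof.
split; last by rewrite (derivation_nat derD); exact: specializes0.
by have := specializes_tofrac phi k%:R; rewrite rmorph_nat tofracMn tofrac1.
Qed.

Lemma jet1 : jet 1 1 0.
Proof. exact: (jet_nat 1). Qed.

Lemma jetX u e e1 k : jet u e e1 -> jet (u ^+ k) (e ^+ k) (k%:R * e ^+ k.-1 * e1).
Proof.
move=> ue; elim: k => [|k IHk]; first by rewrite !mul0r; exact: jet1.
rewrite !exprS; apply: (jet_eq (jetM ue IHk)) => //.
by case: k {IHk} => [|k] /=; rewrite ?exprS; ring.
Qed.

End Jets.

(** * Functions without pole *)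

Section Regular.
Variable E : fieldType.
Implicit Types g h : E -> E.

Definition regular g : Prop := exists p : {poly E}, forall s, s != 0 -> g s = p.[s].

Lemma regular_poly (p : {poly E}) : regular (fun s => p.[s]).
Proof. by exists p. Qed.

Lemma eq_regular g h : regular h -> (forall s, s != 0 -> g s = h s) -> regular g.
Proof. by move=> [p hE] gh; exists p => s s0; rewrite gh ?hE. Qed.

Lemma regularN g : regular g -> regular (fun s => - g s).
Proof. by move=> [p gE]; exists (- p) => s s0; rewrite gE // hornerN. Qed.

Lemma regularB g h : regular g -> regular h -> regular (fun s => g s - h s).
Proof. by move=> [p gE] [r hE]; exists (p - r) => s s0; rewrite gE ?hE // hornerD hornerN. Qed.

Lemma regularM g h : regular g -> regular h -> regular (fun s => g s * h s).
Proof. by move=> [p gE] [r hE]; exists (p * r) => s s0; rewrite gE ?hE // hornerM. Qed.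

Hypothesis pchar_E : [pchar E] =i pred0.

Lemma natr_neq0 n : n.+1%:R != 0 :> E.
Proof. by rewrite (GRing.pcharf0P _).1. Qed.

Lemma natr_injective : injective (fun n => n%:R : E).
Proof.
move=> m n; wlog le_mn : m n / (m <= n)%N.
  by move=> le_inj; case/orP: (leq_total m n) => [/le_inj|/le_inj ge_inj] // /esym /ge_inj.
move=> /eqP; rewrite eq_sym -subr_eq0 -natrB //.
rewrite (GRing.pcharf0P _).1 // subn_eq0 => le_nm.
by apply/eqP; rewrite eqn_leq le_mn.
Qed.

Lemma poly_eq0_horner (p : {poly E}) : (forall s, s != 0 -> p.[s] = 0) -> p = 0.
Proof.
move=> p0; apply/eqP; apply: contraT => pn0.
have := @max_poly_roots _ p [seq n.+1%:R | n <- iota 0 (size p)] pn0.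
rewrite size_map size_iota ltnn => -> //.
  by apply/allP => _ /mapP[n _ ->]; apply/eqP/p0/natr_neq0.
by rewrite map_inj_uniq ?iota_uniq // => m n /natr_injective [].
Qed.

(* The rows of [l] list, by increasing powers of [u], the coefficients of the successive
   powers of [s] in [s ^+ N * g u s]. *)
Lemma regular_pole_coef (g : E -> E -> E) N (l : seq (seq E)) :
  (forall u, regular (g u)) ->
  (forall u s, s != 0 -> s ^+ N * g u s = horner_rec [seq horner_rec r u | r <- l] s) ->
  forall k j, (k < N)%N -> (nth [::] l k)`_j = 0.
Proof.
move=> reg_g gE k j lt_kN; rewrite -coef_Poly.
suff -> : Poly (nth [::] l k) = 0 by rewrite coef0.
apply: poly_eq0_horner => u _; have [p pE] := reg_g u.
have lE : Poly [seq horner_rec r u | r <- l] = 'X^N * p.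
  apply/eqP; rewrite -subr_eq0; apply/eqP/poly_eq0_horner => s s0.
  by rewrite hornerD hornerN hornerM hornerXn horner_Poly -gE // -pE // subrr.
have := congr1 (fun r : {poly E} => r`_k) lE.
rewrite coefXnM lt_kN coef_Poly horner_Poly => <-.
case: (ltnP k (size l)) => [lt_kl|le_lk]; first by rewrite (nth_map [::]).
by rewrite !nth_default ?size_map.
Qed.

End Regular.

Section CurveRegularity.
Variables (E : fieldType) (n : nat).
Local Notation LE := {fraction {mpoly E[n]}}.
Variables (D : LE -> LE) (U : 'I_n -> LE) (v : E -> 'I_n -> E).
Variables (p : 'I_n -> {poly E}) (d : 'I_n -> E -> E).

Lemma horner_mmap (P : {mpoly E[n]}) s : (mmap polyC p P).[s] = P.@[fun i => (p i).[s]].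
Proof.
rewrite /meval /mmap horner_sum; apply: eq_bigr => m _.
rewrite hornerM hornerC; congr (_ * _).
by rewrite /mmap1 horner_prod; apply: eq_bigr => i _; rewrite horner_exp.
Qed.

Hypothesis U_poly : forall i, exists P, D (U i) = mmap (fun c => (c%:MP)%:F) U P.
Hypothesis jet_U : forall s i, s != 0 -> jet (meval (v s)) D (U i) (p i).[s] (d i s).

Lemma regular_jet i : regular (d i).
Proof.
have [P DU] := U_poly i; exists (mmap polyC p P) => s s0; rewrite horner_mmap.
have [_ d_s] := jet_U i s0; apply: specializes_inj d_s _.
by rewrite DU; apply: specializes_mmap => j; have [] := jet_U j s0.
Qed.

End CurveRegularity.

(** * Quadratic polynomials *)

(* [c i j] is the coefficient of [h_i h_j], where [h_0, ..., h_5 = 1, x, y, z, w, q] and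
   [i <= j]. *)
Definition quad (R : pzRingType) (c : nat -> nat -> R) (x y z w q : R) : R :=
  c 0 0 + c 0 1 * x + c 0 2 * y + c 0 3 * z + c 0 4 * w + c 0 5 * q
  + c 1 1 * x ^+ 2 + c 1 2 * (x * y) + c 1 3 * (x * z) + c 1 4 * (x * w) + c 1 5 * (x * q)
  + c 2 2 * y ^+ 2 + c 2 3 * (y * z) + c 2 4 * (y * w) + c 2 5 * (y * q)
  + c 3 3 * z ^+ 2 + c 3 4 * (z * w) + c 3 5 * (z * q)
  + c 4 4 * w ^+ 2 + c 4 5 * (w * q) + c 5 5 * q ^+ 2.

Lemma quadD (R : comPzRingType) (c d : nat -> nat -> R) (x y z w q : R) :
  quad (fun i j => c i j + d i j) x y z w q = quad c x y z w q + quad d x y z w q.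
Proof. by rewrite /quad; ring. Qed.

Lemma quadB (R : comPzRingType) (c d : nat -> nat -> R) (x y z w q : R) :
  quad (fun i j => c i j - d i j) x y z w q = quad c x y z w q - quad d x y z w q.
Proof. by rewrite /quad; ring. Qed.

Lemma eq_quad (R : pzRingType) (c d : nat -> nat -> R) (x y z w q : R) :
  (forall i j, c i j = d i j) -> quad c x y z w q = quad d x y z w q.
Proof. by move=> cd; rewrite /quad !cd. Qed.

Lemma rmorph_quad (R S : pzRingType) (phi : {rmorphism R -> S}) c (x y z w q : R) :
  phi (quad c x y z w q) =
  quad (fun i j => phi (c i j)) (phi x) (phi y) (phi z) (phi w) (phi q).
Proof. by rewrite /quad !(rmorphD, rmorphM, rmorphXn). Qed.

Lemma quad_monomial (R : comPzRingType) (e x y z w q : R) i j : (i <= j <= 5)%N ->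
  quad (fun k l => e *+ ((k == i) && (l == j))) x y z w q =
  e * (nth 0 [:: 1; x; y; z; w; q] i * nth 0 [:: 1; x; y; z; w; q] j).
Proof.
by case: i j => [|[|[|[|[|[|i]]]]]] [|[|[|[|[|[|j]]]]]] /andP[] // _ _;
  rewrite /quad /=; ring.
Qed.

Definition xdiff (R : pzRingType) (c : nat -> nat -> R) (i j : nat) : R :=
  match i, j with
  | 0%N, 0%N => c 0 1 + c 1 1
  | 0%N, 1%N => c 1 1 *+ 2
  | 0%N, _ => c 1 j
  | _, _ => 0
  end.

Lemma quad_xdiff (R : comPzRingType) (c : nat -> nat -> R) (x y z w q : R) :
  quad (xdiff c) x y z w q = quad c (x + 1) y z w q - quad c x y z w q.
Proof. by rewrite /quad /=; ring. Qed.

Lemma eq_by_multiple (R : pzRingType) (k e l r : R) : e = 0 -> l - r = k * e -> l = r.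
Proof. by move=> ->; rewrite mulr0 => /eqP; rewrite subr_eq0 => /eqP. Qed.
Arguments eq_by_multiple {R} k {e l r}.

Lemma quad_cst_coef0 (E : fieldType) (c : nat -> nat -> E) (e : E) :
  [pchar E] =i pred0 ->
  (forall x y z w q, quad c x y z w q = e) ->
  forall i j, (i <= j <= 5)%N -> (0 < j)%N -> c i j = 0.
Proof.
move=> /natr_neq0 natE cE.
pose v (r : E) (i : nat) (r' : E) (j k : nat) := if k == i then r else if k == j then r' else 0.
pose Q r i r' j := quad c (v r i r' j 1) (v r i r' j 2) (v r i r' j 3) (v r i r' j 4)
  (v r i r' j 5).
have polarization i j : (0 < i < j)%N -> (j <= 5)%N ->
    c i j = Q 1 i 1 j - Q 1 i 0 j - Q 0 i 1 j + Q 0 i 0 j.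
  case: i j => [|[|[|[|[|[|i]]]]]] [|[|[|[|[|[|j]]]]]] // _ _;
    by rewrite /Q /v /quad /=; ring.
have diagonal i : (0 < i <= 5)%N -> c i i = (Q 1 i 0 0 + Q (-1) i 0 0) / 2%:R - Q 0 i 0 0.
  case: i => [|[|[|[|[|[|i]]]]]] // _; rewrite /Q /v /quad /=; field; exact: natE 1.
have linear i : (0 < i <= 5)%N -> c 0%N i = (Q 1 i 0 0 - Q (-1) i 0 0) / 2%:R.
  case: i => [|[|[|[|[|[|i]]]]]] // _; rewrite /Q /v /quad /=; field; exact: natE 1.
move=> i j /andP[le_ij le_j5] j0; case: (posnP i) => [->|i0].
  by rewrite linear ?j0 // /Q !cE subrr mul0r.
move: le_ij; rewrite leq_eqVlt => /orP[/eqP eq_ij|lt_ij].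
  by rewrite eq_ij diagonal ?j0 // /Q !cE; field; exact: natE 1.
by rewrite polarization ?i0 // /Q !cE subrr sub0r addNr.
Qed.

Definition quad_seq (R : pzRingType) (c : nat -> nat -> R) (l : seq R) : R :=
  quad c l`_0 l`_1 l`_2 l`_3 l`_4.

Section QuadraticMpoly.
Variable E : comNzRingType.

Definition mquad (c : nat -> nat -> E) : {mpoly E[5]} :=
  quad (fun i j => (c i j)%:MP) 'X_(inord 0) 'X_(inord 1) 'X_(inord 2) 'X_(inord 3)
    'X_(inord 4).

Definition point (l : seq E) (i : 'I_5) : E := l`_i.

Lemma meval_mquad c (l : seq E) : (mquad c).@[point l] = quad_seq c l.
Proof.
rewrite /mquad rmorph_quad /= !mevalXU /point !inordK //=.
by apply: eq_quad => i j; rewrite mevalC.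
Qed.

Lemma mquad_monomial (e : E) (i j : nat) : (i <= 5)%N -> (j <= 5)%N ->
  let h k : {mpoly E[5]} := if k is k'.+1 then 'X_(inord k') else 1 in
  exists c, e *: (h i * h j) = mquad c.
Proof.
move=> le_i5 le_j5 h; wlog le_ij : i j le_i5 le_j5 / (i <= j)%N.
  by move=> mon_le; case/orP: (leq_total i j) => /mon_le; [|rewrite mulrC]; exact.
have hE k : (k <= 5)%N -> h k = nth 0 [:: 1; 'X_(inord 0); 'X_(inord 1); 'X_(inord 2);
    'X_(inord 3); 'X_(inord 4)] k by case: k => [|[|[|[|[|[|k]]]]]].
exists (fun k l => e *+ ((k == i) && (l == j))).
rewrite -mul_mpolyC !hE // -quad_monomial ?le_ij //.
by apply: eq_quad => k l; rewrite mpolyCMn.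
Qed.

Lemma eq_mquad_cst c d : (forall i j, (i <= j <= 5)%N -> (0 < j)%N -> c i j = d i j) ->
  mquad c = mquad d + (c 0%N 0%N - d 0%N 0%N)%:MP.
Proof. by move=> cd; rewrite /mquad /quad !(cd _ _.+1) // mpolyCB; ring. Qed.

Lemma mdeg_gt0_split (n : nat) (m : 'X_{1..n}) : (0 < mdeg m)%N ->
  exists i m', m = (U_(i) + m')%MM /\ mdeg m = (mdeg m').+1.
Proof.
move=> m0; have [i mi] : exists i, (0 < m i)%N.
  apply/existsP; apply: contraTT m0; rewrite negb_exists -leqNgt leqn0 mdegE => /forallP m_le0.
  by rewrite big1 // => i _; apply/eqP; rewrite -leqn0 leqNgt m_le0.
have mE : m = (U_(i) + (m - U_(i)))%MM by rewrite addmC submK // lep1mP -lt0n.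
by exists i, (m - U_(i))%MM; split=> //; rewrite {1}mE mdegD mdeg1.
Qed.

Lemma mquad_exists (P : {mpoly E[5]}) : (msize P <= 3)%N -> exists c, P = mquad c.
Proof.
move=> sP; rewrite [P]mpolyE big_seq; apply: (big_ind (fun Q => exists c, Q = mquad c)).
- have [c cE] := @mquad_monomial 0 0 0 isT isT.
  by exists c; rewrite -cE scale0r.
- move=> _ _ [c ->] [d ->]; exists (fun i j => c i j + d i j).
  by rewrite /mquad -quadD /quad !mpolyCD.
move=> m /msize_mdeg_lt /leq_trans /(_ sP); move: (P@_m) => e.
case: (posnP (mdeg m)) => [/eqP|/mdeg_gt0_split [i [m' [-> ->]]]].
  rewrite mdeg_eq0 => /eqP -> _; have [c cE] := @mquad_monomial e 0 0 isT isT.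
  by exists c; rewrite -cE mpolyX0 mulr1.
have i5 := ltn_ord i.
case: (posnP (mdeg m')) => [/eqP|/mdeg_gt0_split [j [m'' [-> ->]]]].
  rewrite mdeg_eq0 => /eqP -> _; have [c cE] := @mquad_monomial e 0 i.+1 isT i5.
  by exists c; rewrite -cE addm0 mul1r inord_val.
rewrite !ltnS leqn0 mdeg_eq0 => /eqP ->.
have [c cE] := @mquad_monomial e i.+1 j.+1 i5 (ltn_ord j).
by exists c; rewrite -cE addm0 mpolyXD !inord_val.
Qed.

End QuadraticMpoly.

(** * Vector fields in the charts [r1] and [r2] *)

Section Charts.
Variables (E : fieldType) (t a : E).
Implicit Types (f : nat -> E -> E) (c : nat -> nat -> E) (v : nat -> nat -> nat -> E).

(* The original coordinates of the point of the chart [r_i] with [x_i], [y_i], [z_i] equal to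
   [x], [y], [z], with [w_i = 0] and [q_i = s]. *)
Definition chart1_coords (x y z s : E) : seq E := [:: x; y; z; - (a - 2%:R^-1) * s; s^-1].

Definition chart2_coords (x y z s : E) : seq E :=
  [:: x - s^-1 / 2%:R; y - s^-1 ^+ 2 / 4%:R; z + 2%:R * y * s^-1 - s^-1 ^+ 3 / 4%:R;
    - t / 2%:R + 4%:R * y ^+ 2 + y * s^-1 ^+ 2 + 2%:R * z * s^-1 + (2%:R^-1 + a) * s; s^-1].

(* At this point, the derivatives of [x_i], [y_i], [z_i], [w_i], [q_i] when [f] gives those of
   [x], [y], [z], [w], [q], and [h] is the derivative of [t]. *)
Definition chart1_velocity f (i : nat) (s : E) : E :=
  [:: f 0%N s; f 1%N s; f 2%N s; - f 3%N s / s ^+ 2 + (a - 2%:R^-1) * f 4%N s;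
    - f 4%N s * s ^+ 2]`_i.

Definition chart2_velocity (h y z : E) f (i : nat) (s : E) : E :=
  [:: f 0%N s + f 4%N s / 2%:R;
    f 1%N s + s^-1 / 2%:R * f 4%N s;
    f 2%N s - 2%:R / s * f 1%N s - (s ^- 2 / 4%:R + 2%:R * y) * f 4%N s;
    - (f 3%N s + h / 2%:R - (8%:R * y - 3%:R / s ^+ 2) * f 1%N s
       - 2%:R / s * f 2%N s - (2%:R * z + 2%:R * y / s) * f 4%N s) / s ^+ 2
    - (2%:R^-1 + a) * f 4%N s;
    - f 4%N s * s ^+ 2]`_i.

Lemma eq_chart1_velocity f g i s : (forall k, f k s = g k s) ->
  chart1_velocity f i s = chart1_velocity g i s.
Proof. by move=> fg; rewrite /chart1_velocity !fg. Qed.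

Lemma eq_chart2_velocity h y z f g i s : (forall k, f k s = g k s) ->
  chart2_velocity h y z f i s = chart2_velocity h y z g i s.
Proof. by move=> fg; rewrite /chart2_velocity !fg. Qed.

Definition quad_chart1 c (x y z s : E) : E := quad_seq c (chart1_coords x y z s).

Definition quad_chart2 c (x y z s : E) : E := quad_seq c (chart2_coords x y z s).

Definition regular_in_charts (h : E) v : Prop := forall x y z i, (i < 5)%N ->
  regular (chart1_velocity (fun k => quad_chart1 (v k) x y z) i) /\
  regular (chart2_velocity h y z (fun k => quad_chart2 (v k) x y z) i).

End Charts.

Section QuadraticFields.
Variable E : fieldType.
Hypothesis pchar_E : [pchar E] =i pred0.
Let natE := natr_neq0 pchar_E.
Variables t a : E.
Implicit Types (c : nat -> nat -> E) (v : nat -> nat -> nat -> E).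
Local Notation quad_chart1 := (quad_chart1 a).
Local Notation quad_chart2 := (quad_chart2 t a).
Local Notation regular_in_charts := (regular_in_charts t a).

Lemma chart1_velocityB f f' g i s : s != 0 -> (forall k, g k s = f k s - f' k s) ->
  chart1_velocity a g i s = chart1_velocity a f i s - chart1_velocity a f' i s.
Proof.
move=> s0 gE; case: i => [|[|[|[|[|i]]]]]; rewrite /chart1_velocity /= !(gE, nth_nil);
  by field; rewrite ?s0 ?natE.
Qed.

Lemma chart2_velocityB h h' y z f f' g i s : s != 0 ->
  (forall k, g k s = f k s - f' k s) ->
  chart2_velocity a (h - h') y z g i s =
  chart2_velocity a h y z f i s - chart2_velocity a h' y z f' i s.
Proof.
move=> s0 gE; case: i => [|[|[|[|[|i]]]]]; rewrite /chart2_velocity /= !(gE, nth_nil);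
  by field; rewrite ?s0 ?natE.
Qed.

Lemma regular_in_chartsB h h' v v' :
  regular_in_charts h v -> regular_in_charts h' v' ->
  regular_in_charts (h - h') (fun k i j => v k i j - v' k i j).
Proof.
move=> reg_v reg_v' x y z i lt_i5.
have [r1 r2] := reg_v x y z i lt_i5; have [r1' r2'] := reg_v' x y z i lt_i5; split.
  apply: eq_regular (regularB r1 r1') _ => s s0.
  by apply: chart1_velocityB => // k; exact: quadB.
apply: eq_regular (regularB r2 r2') _ => s s0.
by apply: chart2_velocityB => // k; exact: quadB.
Qed.

(* The charts commute with the translations of [x]. *)
Lemma regular_in_charts_xdiff h v :
  regular_in_charts h v -> regular_in_charts 0 (fun k => xdiff (v k)).
Proof.
move=> reg_v x y z i lt_i5; rewrite -[0](subrr h).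
have [r1 r2] := reg_v (x + 1) y z i lt_i5; have [r1' r2'] := reg_v x y z i lt_i5; split.
  apply: eq_regular (regularB r1 r1') _ => s s0.
  by apply: chart1_velocityB => // k; exact: quad_xdiff.
apply: eq_regular (regularB r2 r2') _ => s s0; apply: chart2_velocityB => // k.
by rewrite /quad_chart2 /quad_seq /= quad_xdiff [x + 1 - _]addrAC.
Qed.

Lemma regular_quad_chart1 c : (forall y z, regular (quad_chart1 c 0 y z)) ->
  [/\ c 0 5 = 0, c 2 5 = 0, c 3 5 = 0 & c 5 5 = 0].
Proof.
move=> reg_c; pose b := a - 2%:R^-1.
have pole k j (lt_k2 : (k < 2)%N) : (nth [::] [::
    [:: c 5 5];
    [:: c 0 5; c 2 5; c 3 5];
    [:: c 0 0 - b * c 4 5; c 0 2; c 0 3 + c 2 2; c 2 3; c 3 3];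
    [:: - b * c 0 4; - b * c 2 4; - b * c 3 4];
    [:: b ^+ 2 * c 4 4]] k)`_j = 0.
  apply: (regular_pole_coef pchar_E (fun u => reg_c u (u ^+ 2))) lt_k2 => u s s0.
  by rewrite /quad_chart1 /quad_seq /quad /b /=; field; rewrite s0 !natE.
by split; [exact: (pole 1 0)|exact: (pole 1 1)|exact: (pole 1 2)|exact: (pole 0 0)].
Qed.

Definition quad_chart2_laurent c : seq (seq E) :=
  let b := a + 2%:R^-1 in
  [::
    [:: c 3 3 / 16%:R];
    [:: c 2 3 / 16%:R; - c 3 4 / 4%:R];
    [:: c 2 2 / 16%:R - c 3 5 / 4%:R; - c 2 4 / 4%:R - c 3 3; c 4 4];
    [:: - c 0 3 / 4%:R - c 2 5 / 4%:R + t * c 3 4 / 8%:R; c 4 5 - 3%:R * c 2 3 / 4%:R;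
        c 3 4];
    [:: c 5 5 - c 0 2 / 4%:R + t * c 2 4 / 8%:R - b * c 3 4 / 4%:R;
        c 0 4 - c 2 2 / 2%:R + 2%:R * c 3 5 - t * c 4 4; 4%:R * c 3 3; 8%:R * c 4 4];
    [:: c 0 5 - c 0 1 / 2%:R - b * c 2 4 / 4%:R - t * c 4 5 / 2%:R;
        2%:R * b * c 4 4 + 2%:R * c 0 3 + c 2 5 - t * c 3 4;
        2%:R * c 2 3 + 4%:R * c 4 5; 8%:R * c 3 4];
    [:: b * c 4 5 + c 0 0 - t * c 0 4 / 2%:R + t ^+ 2 * c 4 4 / 4%:R;
        2%:R * b * c 3 4 + c 0 2 - t * c 2 4 / 2%:R; 4%:R * c 0 4 + c 2 2 - 4%:R * t * c 4 4;
        4%:R * c 2 4; 16%:R * c 4 4];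
    [:: b * c 0 4 - t * b * c 4 4; b * c 2 4; 8%:R * b * c 4 4];
    [:: b ^+ 2 * c 4 4]].

Lemma quad_chart2E c u s : s != 0 -> (forall j, (0 < j <= 5)%N -> c 1 j = 0) ->
  s ^+ 6 * quad_chart2 c 0 u 0 s =
  horner_rec [seq horner_rec r u | r <- quad_chart2_laurent c] s.
Proof.
move=> s0 c1; rewrite /quad_chart2 /quad_seq /quad !c1 //=.
by field; rewrite s0 !natE.
Qed.

Lemma regular_quad_chart2 c m : (m <= 6)%N -> (forall j, (0 < j <= 5)%N -> c 1 j = 0) ->
  (forall y, regular (fun s => s ^+ (6 - m) * quad_chart2 c 0 y 0 s)) ->
  [/\ (1 < m)%N -> [/\ c 2 3 = 0, c 3 3 = 0 & c 3 4 = 0],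
      (2 < m)%N -> [/\ c 2 4 = 0, c 4 4 = 0 & c 3 5 = c 2 2 / 4%:R]
    & (3 < m)%N -> c 4 5 = 0 /\ c 2 5 = - c 0 3].
Proof.
move=> le_m6 c1 reg_c.
have pole k j (lt_km : (k < m)%N) : (nth [::] (quad_chart2_laurent c) k)`_j = 0.
  apply: (regular_pole_coef pchar_E reg_c) lt_km => u s s0.
  by rewrite mulrA -exprD subnKC // quad_chart2E.
have rows01 (lt1m : (1 < m)%N) : [/\ c 2 3 = 0, c 3 3 = 0 & c 3 4 = 0].
  have lt0m := ltnW lt1m; split.
  - by apply: (eq_by_multiple 16%:R (pole 1 0 lt1m)) => /=; field; rewrite !natE.
  - by apply: (eq_by_multiple 16%:R (pole 0 0 lt0m)) => /=; field; rewrite !natE.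
  - by apply: (eq_by_multiple (- 4%:R) (pole 1 1 lt1m)) => /=; field; rewrite !natE.
have row2 (lt2m : (2 < m)%N) : [/\ c 2 4 = 0, c 4 4 = 0 & c 3 5 = c 2 2 / 4%:R].
  have [_ c33 _] := rows01 (ltnW lt2m); split.
  - by apply: (eq_by_multiple (- 4%:R) (pole 2 1 lt2m)); rewrite /= c33; field; rewrite !natE.
  - exact: (pole 2 2 lt2m).
  - by apply: (eq_by_multiple (- 4%:R) (pole 2 0 lt2m)) => /=; field; rewrite !natE.
split=> // lt3m; have [c23 _ c34] := rows01 (ltnW (ltnW lt3m)); split.
  by apply: (eq_by_multiple 1 (pole 3 1 lt3m)); rewrite /= c23; field; rewrite !natE.
by apply: (eq_by_multiple (- 4%:R) (pole 3 0 lt3m)); rewrite /= c34; field; rewrite !natE.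
Qed.

Section XFreeField.
Variable c : nat -> nat -> nat -> E.
Arguments c (_ _ _)%_nat_scope.
Local Notation cx := (c 0).
Local Notation cy := (c 1).
Local Notation cz := (c 2).
Local Notation cw := (c 3).
Local Notation cq := (c 4).
Hypothesis reg_c : regular_in_charts 0 c.
Hypothesis x_free : forall k j, (k < 5)%N -> (0 < j <= 5)%N -> c k 1 j = 0.
Hypothesis x_free1 : forall k, (0 < k < 5)%N -> c k 0 1 = 0.

Let reg1 k y z (lt_k5 : (k < 5)%N) := (reg_c 0 y z lt_k5).1.
Let reg2 k y (lt_k5 : (k < 5)%N) := (reg_c 0 y 0 lt_k5).2.

Lemma cq_support x y z w q : quad cq x y z w q =
  cq 0 0 + cq 0 2 * y + cq 0 4 * w + cq 0 5 * q + cq 5 5 * q ^+ 2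
  + cq 0 3 * (z - y * q) + cq 2 2 * (y ^+ 2 + z * q / 4%:R).
Proof.
have [|[] // c23 c33 c34 [] // c24 c44 c35 [] // c45 c25] :=
    @regular_quad_chart2 cq 4 isT (fun j => @x_free 4 j isT).
  move=> u; apply: eq_regular (regularN (@reg2 4 u isT)) _ => s _.
  by rewrite /chart2_velocity /=; ring.
rewrite /quad !x_free // !x_free1 // c23 c33 c34 c24 c44 c35 c45 c25.
by field; rewrite !natE.
Qed.

(* By the condition in [r2], the polar part of each component is a combination of those of
   the components treated before, in the order q, x, y, z, w; this bounds its pole. *)
Lemma cx_support x y z w q :
  quad cx x y z w q = cx 0 0 + cx 0 1 * x + cx 0 2 * y + cx 0 4 * w.
Proof.
have [x05 x25 x35 x55] := regular_quad_chart1 (fun y z => @reg1 0 y z isT).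
have [|[] // x23 x33 x34 [] // x24 x44 /esym x22 [] // x45 /esym x03] :=
    @regular_quad_chart2 cx 4 isT (fun j => @x_free 0 j isT).
  move=> u; apply: eq_regular (regularB (regularM (regular_poly 'X^2) (@reg2 0 u isT))
    (regularM (regular_poly (- (2%:R^-1)%:P)) (@reg2 4 u isT))) _ => s s0.
  by rewrite hornerXn hornerN hornerC /chart2_velocity /=; field; rewrite !natE.
rewrite x35 in x22; rewrite x25 in x03.
have {}x22 : cx 2 2 = 0 by apply: (eq_by_multiple 4%:R x22); field; rewrite !natE.
have {}x03 : cx 0 3 = 0 by apply: (eq_by_multiple (- 1) x03); ring.
rewrite /quad !x_free // x05 x25 x35 x55 x23 x33 x34 x24 x44 x45 x22 x03.
by ring.
Qed.

Lemma cx_form : [/\ cq 0 5 = cx 0 1, cq 0 3 = 0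
  & forall x y z w q, quad cx x y z w q =
      cx 0 0 + cx 0 1 * x + (2%:R * cq 5 5 - cq 0 2 / 2%:R) * y - cq 0 4 / 2%:R * w].
Proof.
have pole k j (lt_k2 : (k < 2)%N) : (nth [::] [::
    [:: cq 5 5 / 2%:R - cq 0 2 / 8%:R - cx 0 2 / 4%:R; cq 0 4 / 2%:R + cx 0 4];
    [:: (cq 0 5 - cx 0 1) / 2%:R; cq 0 3 / 2%:R];
    [:: cq 0 0 / 2%:R - t * cq 0 4 / 4%:R + cx 0 0 - t * cx 0 4 / 2%:R;
        cq 0 2 / 2%:R + cx 0 2; 2%:R * cq 0 4 + cq 2 2 / 2%:R + 4%:R * cx 0 4];
    [:: (a + 2%:R^-1) * (cq 0 4 / 2%:R + cx 0 4)]] k)`_j = 0.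
  apply: (regular_pole_coef pchar_E (fun u => @reg2 0 u isT)) lt_k2 => u s s0.
  rewrite /chart2_velocity /= /quad_chart2 /quad_seq /= cq_support cx_support.
  by field; rewrite s0 !natE.
split.
- by apply: (eq_by_multiple 2%:R (pole 1 0 isT)) => /=; field; rewrite !natE.
- by apply: (eq_by_multiple 2%:R (pole 1 1 isT)) => /=; field; rewrite !natE.
- move=> x y z w q; rewrite cx_support.
  have -> : cx 0 2 = 2%:R * cq 5 5 - cq 0 2 / 2%:R.
    by apply: (eq_by_multiple (- 4%:R) (pole 0 0 isT)) => /=; field; rewrite !natE.
  have -> : cx 0 4 = - cq 0 4 / 2%:R.
    by apply: (eq_by_multiple 1 (pole 0 1 isT)) => /=; field; rewrite !natE.
  by field; rewrite !natE.
Qed.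

Lemma cy_support x y z w q :
  quad cy x y z w q = cy 0 0 + cy 0 2 * y + cy 0 3 * z + cy 0 4 * w + cy 4 5 * (w * q).
Proof.
have [y05 y25 y35 y55] := regular_quad_chart1 (fun y z => @reg1 1 y z isT).
have [|[] // y23 y33 y34 [] // y24 y44 /esym y22 _] :=
    @regular_quad_chart2 cy 3 isT (fun j => @x_free 1 j isT).
  move=> u; apply: eq_regular (regularB (regularM (regular_poly 'X^3) (@reg2 1 u isT))
    (regularM (regular_poly (- (2%:R^-1)%:P)) (@reg2 4 u isT))) _ => s s0.
  by rewrite hornerXn hornerN hornerC /chart2_velocity /=; field; rewrite s0 !natE.
rewrite y35 in y22.
have {}y22 : cy 2 2 = 0 by apply: (eq_by_multiple 4%:R y22); field; rewrite !natE.
rewrite /quad !x_free // !x_free1 // y05 y25 y35 y55 y23 y33 y34 y24 y44 y22.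
by ring.
Qed.

Lemma cy_form : [/\ cq 0 0 = 0, cq 2 2 = 0, cq 0 2 = 8%:R * cq 5 5
  & forall x y z w q, quad cy x y z w q =
      cy 0 0 + 2%:R * cx 0 1 * y - 2%:R * cq 5 5 * z - cq 0 4 / 2%:R * (w * q)].
Proof.
have [cq05 cq03 _] := cx_form.
have pole k j (lt_k3 : (k < 3)%N) : (nth [::] [::
    [:: cq 5 5 / 2%:R - cq 0 2 / 8%:R - cy 0 3 / 4%:R; cq 0 4 / 2%:R + cy 4 5];
    [:: cx 0 1 / 2%:R - cy 0 2 / 4%:R; cy 0 4];
    [:: cq 0 0 / 2%:R - t / 2%:R * (cq 0 4 / 2%:R + cy 4 5); cq 0 2 / 2%:R + 2%:R * cy 0 3;
        2%:R * cq 0 4 + cq 2 2 / 2%:R + 4%:R * cy 4 5];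
    [:: (a + 2%:R^-1) * (cq 0 4 / 2%:R + cy 4 5) + cy 0 0 - t * cy 0 4 / 2%:R; cy 0 2;
        4%:R * cy 0 4];
    [:: (a + 2%:R^-1) * cy 0 4]] k)`_j = 0.
  apply: (regular_pole_coef pchar_E (fun u => @reg2 1 u isT)) lt_k3 => u s s0.
  rewrite /chart2_velocity /= /quad_chart2 /quad_seq /= cq_support cq05 cq03 cy_support.
  by field; rewrite s0 !natE.
have y45 : cy 4 5 = - cq 0 4 / 2%:R.
  by apply: (eq_by_multiple 1 (pole 0 1 isT)) => /=; field; rewrite !natE.
have y04 : cy 0 4 = 0 by exact: (pole 1 1 isT).
have y02 : cy 0 2 = 2%:R * cx 0 1.
  by apply: (eq_by_multiple (- 4%:R) (pole 1 0 isT)) => /=; field; rewrite !natE.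
have q02 : cq 0 2 = - 4%:R * cy 0 3.
  by apply: (eq_by_multiple 2%:R (pole 2 1 isT)) => /=; field; rewrite !natE.
have y03 : cy 0 3 = - 2%:R * cq 5 5.
  by apply: (eq_by_multiple 4%:R (pole 0 0 isT)) => /=; rewrite q02; field; rewrite !natE.
split.
- by apply: (eq_by_multiple 2%:R (pole 2 0 isT)); rewrite /= y45; field; rewrite !natE.
- by apply: (eq_by_multiple 2%:R (pole 2 2 isT)); rewrite /= y45; field; rewrite !natE.
- by rewrite q02 y03; ring.
- by move=> x y z w q; rewrite cy_support y45 y04 y02 y03; field; rewrite !natE.
Qed.

Lemma cq_form x y z w q :
  quad cq x y z w q = 8%:R * cq 5 5 * y + cq 0 4 * w + cx 0 1 * q + cq 5 5 * q ^+ 2.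
Proof.
have [cq05 cq03 _] := cx_form; have [cq00 cq22 cq02 _] := cy_form.
by rewrite cq_support cq05 cq03 cq00 cq22 cq02; ring.
Qed.

Lemma cz_support x y z w q : quad cz x y z w q =
  cz 0 0 + cz 0 2 * y + cz 0 3 * z + cz 0 4 * w + cz 2 2 * y ^+ 2 + cz 2 4 * (y * w)
  + cz 4 4 * w ^+ 2 + cz 4 5 * (w * q).
Proof.
have [z05 z25 z35 z55] := regular_quad_chart1 (fun y z => @reg1 2 y z isT).
have [|[] // z23 z33 z34 _ _] := @regular_quad_chart2 cz 2 isT (fun j => @x_free 2 j isT).
  move=> u; apply: eq_regular (regularB (regularM (regular_poly 'X^4) (@reg2 2 u isT))
   (regularB (regularM (regular_poly (- 2%:R *: 'X^3)) (@reg2 1 u isT))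
    (regularM (regular_poly ((3%:R / 4%:R)%:P - (2%:R * u) *: 'X^2)) (@reg2 4 u isT))))
    _ => s s0.
  by rewrite !hornerE /chart2_velocity /=; field; rewrite s0 !natE.
by rewrite /quad !x_free // !x_free1 // z05 z25 z35 z55 z23 z33 z34; ring.
Qed.

Lemma cz_polar_coef0 k j : (k < 4)%N -> let b := a + 2%:R^-1 in (nth [::] [::
    [:: (cz 2 2 - 12%:R * cq 5 5) / 16%:R; (3%:R * cq 0 4 - cz 2 4) / 4%:R; cz 4 4];
    [:: (3%:R * cx 0 1 - cz 0 3) / 4%:R; cz 4 5];
    [:: t / 8%:R * (cz 2 4 - 3%:R * cq 0 4) - cz 0 2 / 4%:R;
        cz 0 4 - cz 2 2 / 2%:R - t * cz 4 4 + 8%:R * cq 5 5; cq 0 4; 8%:R * cz 4 4];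
    [:: b / 4%:R * (3%:R * cq 0 4 - cz 2 4) - t * cz 4 5 / 2%:R - 2%:R * cy 0 0;
        2%:R * b * cz 4 4 + 2%:R * cz 0 3 - 6%:R * cx 0 1; 4%:R * cz 4 5];
    [:: b * cz 4 5 + cz 0 0 - t * cz 0 4 / 2%:R + t ^+ 2 * cz 4 4 / 4%:R;
        cz 0 2 - t * cz 2 4 / 2%:R + t * cq 0 4;
        4%:R * cz 0 4 + cz 2 2 - 4%:R * t * cz 4 4 - 16%:R * cq 5 5;
        4%:R * cz 2 4 - 8%:R * cq 0 4; 16%:R * cz 4 4];
    [:: b * (cz 0 4 - t * cz 4 4); b * (cz 2 4 - 2%:R * cq 0 4); 8%:R * b * cz 4 4];
    [:: b ^+ 2 * cz 4 4]] k)`_j = 0.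
Proof.
have [_ _ _ cyE] := cy_form.
apply: (regular_pole_coef pchar_E (fun u => @reg2 2 u isT)) => u s s0.
rewrite /chart2_velocity /= /quad_chart2 /quad_seq /= cq_form cyE cz_support.
by field; rewrite s0 !natE.
Qed.

Lemma cz_form : [/\ cq 0 4 = 0, cy 0 0 = 0
  & forall x y z w q, quad cz x y z w q =
      cz 0 0 + 3%:R * cx 0 1 * z - 2%:R * cq 5 5 * w + 12%:R * cq 5 5 * y ^+ 2].
Proof.
have pole := cz_polar_coef0.
have q04 : cq 0 4 = 0 by exact: (pole 2 2 isT).
have z44 : cz 4 4 = 0 by exact: (pole 0 2 isT).
have z45 : cz 4 5 = 0 by exact: (pole 1 1 isT).
have z24 : cz 2 4 = 0.
  by apply: (eq_by_multiple (- 4%:R) (pole 0 1 isT)); rewrite /= q04; field; rewrite !natE.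
have z22 : cz 2 2 = 12%:R * cq 5 5.
  by apply: (eq_by_multiple 16%:R (pole 0 0 isT)) => /=; field; rewrite !natE.
have z03 : cz 0 3 = 3%:R * cx 0 1.
  by apply: (eq_by_multiple (- 4%:R) (pole 1 0 isT)) => /=; field; rewrite !natE.
have z04 : cz 0 4 = - 2%:R * cq 5 5.
  by apply: (eq_by_multiple 1 (pole 2 1 isT)); rewrite /= z44 z22; field; rewrite !natE.
have z02 : cz 0 2 = 0.
  by apply: (eq_by_multiple (- 4%:R) (pole 2 0 isT)); rewrite /= z24 q04; field;
    rewrite !natE.
split=> // [|x y z w q]; last by rewrite cz_support z44 z45 z24 z22 z03 z04 z02; ring.
by apply: (eq_by_multiple (- 2%:R^-1) (pole 3 0 isT)); rewrite /= q04 z24 z45; field;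
  rewrite !natE.
Qed.

Lemma cw_support : [/\ cw 0 0 = (a - 2%:R^-1) * (cq 5 5 + cw 4 5),
    (a - 2%:R^-1) * (cq 0 5 + cw 0 4) = 0
  & forall x y z w q, quad cw x y z w q =
      cw 0 0 + cw 0 4 * w + cw 2 4 * (y * w) + cw 3 4 * (z * w) + cw 4 4 * w ^+ 2
      + cw 4 5 * (w * q)].
Proof.
pose b := a - 2%:R^-1.
have pole k j (lt_k4 : (k < 4)%N) : (nth [::] [::
    [:: cw 5 5];
    [:: cw 0 5; cw 2 5; 0; cw 3 5];
    [:: cw 0 0 - b * (cq 5 5 + cw 4 5); cw 0 2; cw 2 2; cw 0 3; cw 2 3; 0; cw 3 3];
    [:: - b * (cq 0 5 + cw 0 4); - b * (cq 2 5 + cw 2 4); 0; - b * (cq 3 5 + cw 3 4)];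
    [:: b ^+ 2 * (cq 4 5 + cw 4 4) - b * cq 0 0; - b * cq 0 2; - b * cq 2 2; - b * cq 0 3;
        - b * cq 2 3; 0; - b * cq 3 3];
    [:: b ^+ 2 * cq 0 4; b ^+ 2 * cq 2 4; 0; b ^+ 2 * cq 3 4];
    [:: - b ^+ 3 * cq 4 4]] k)`_j = 0.
  apply: (regular_pole_coef pchar_E (fun u => regularN (@reg1 3 u (u ^+ 3) isT))) lt_k4.
  move=> u s s0; rewrite /chart1_velocity /= /quad_chart1 /quad_seq /quad /=.
  by rewrite !x_free // !x_free1 // /b; field; rewrite s0 !natE.
split.
- exact: subr0_eq (pole 2 0 isT).
- by apply: (eq_by_multiple (- 1) (pole 3 0 isT)); rewrite /= /b; ring.
- have [w05 w25 w35 w55] : [/\ cw 0 5 = 0, cw 2 5 = 0, cw 3 5 = 0 & cw 5 5 = 0].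
    by split; [exact: (pole 1 0)|exact: (pole 1 1)|exact: (pole 1 3)|exact: (pole 0 0)].
  have [w02 w22 w03] : [/\ cw 0 2 = 0, cw 2 2 = 0 & cw 0 3 = 0].
    by split; [exact: (pole 2 1)|exact: (pole 2 2)|exact: (pole 2 3)].
  have [w23 w33] : cw 2 3 = 0 /\ cw 3 3 = 0.
    by split; [exact: (pole 2 4)|exact: (pole 2 6)].
  move=> x y z w q.
  by rewrite /quad !x_free // !x_free1 // w05 w25 w35 w55 w02 w22 w03 w23 w33; ring.
Qed.

Lemma cw_polar_coef0 k j : (k < 7)%N -> let b := a + 2%:R^-1 in (nth [::] [::
    [:: 0; - cw 3 4 / 4%:R];
    [:: 0; - cw 2 4 / 4%:R; cw 4 4];
    [:: t * cw 3 4 / 8%:R; cw 4 5 + 2%:R * cq 5 5; cw 3 4];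
    [:: t * cw 2 4 / 8%:R - b * cw 3 4 / 4%:R; cw 0 4 - t * cw 4 4 - 4%:R * cx 0 1; 0;
        8%:R * cw 4 4];
    [:: - b * cw 2 4 / 4%:R - t / 2%:R * (cw 4 5 + 4%:R * cq 5 5) - 2%:R * cz 0 0;
        2%:R * b * cw 4 4 - t * cw 3 4; 4%:R * cw 4 5 + 8%:R * cq 5 5; 8%:R * cw 3 4];
    [:: cw 0 0 + b * (cw 4 5 + 3%:R * cq 5 5) - t * cw 0 4 / 2%:R + t ^+ 2 * cw 4 4 / 4%:R;
        2%:R * b * cw 3 4 - t * cw 2 4 / 2%:R;
        4%:R * (cw 0 4 - t * cw 4 4 - 4%:R * cx 0 1); 4%:R * cw 2 4; 16%:R * cw 4 4];
    [:: b * (cw 0 4 + cx 0 1 - t * cw 4 4); b * cw 2 4; 8%:R * b * cw 4 4];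
    [:: b ^+ 2 * cw 4 4; 8%:R * b * cq 5 5]] k)`_j = 0.
Proof.
have [_ _ _ cyE] := cy_form; have [cq04 cy00 czE] := cz_form.
have [_ _ cwE] := cw_support.
apply: (regular_pole_coef pchar_E (fun u => regularN (@reg2 3 u isT))) => u s s0.
rewrite /chart2_velocity /= /quad_chart2 /quad_seq /= cq_form cyE czE cwE cq04 cy00.
by field; rewrite s0 !natE.
Qed.

Lemma cw_form : [/\ cx 0 1 = 0, cq 5 5 = 0, cz 0 0 = 0
  & forall x y z w q, quad cw x y z w q = 0].
Proof.
have [cq05 _ _] := cx_form; have [cw00 cw04 cwE] := cw_support.
have pole := cw_polar_coef0.
have w34 : cw 3 4 = 0 by exact: (pole 2 2 isT).
have w44 : cw 4 4 = 0 by exact: (pole 1 2 isT).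
have w24 : cw 2 4 = 0.
  by apply: (eq_by_multiple (- 4%:R) (pole 1 1 isT)) => /=; field; rewrite !natE.
have w45 : cw 4 5 = - 2%:R * cq 5 5.
  by apply: (eq_by_multiple 1 (pole 2 1 isT)) => /=; ring.
have w04 : cw 0 4 = 4%:R * cx 0 1.
  by apply: (eq_by_multiple 1 (pole 3 1 isT)); rewrite /= w44; ring.
(* Both [a - 1/2] and [a + 1/2] annihilate [5 cx 0 1], hence so does their difference. *)
have x01 : cx 0 1 = 0.
  apply: (eq_by_multiple 5%:R^-1 (pole 6 0 isT)); apply: (eq_by_multiple (- 5%:R^-1) cw04).
  by rewrite /= cq05 w04 w44; field; rewrite !natE.
have q55 : cq 5 5 = 0.
  by apply: (eq_by_multiple 1 (pole 5 0 isT)); rewrite /= cw00 w45 w04 w44 x01; field;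
    rewrite !natE.
split=> // [|x y z w q]; last by rewrite cwE cw00 w45 w04 w24 w34 w44 q55 x01; ring.
by apply: (eq_by_multiple (- 2%:R^-1) (pole 4 0 isT)); rewrite /= w24 w45 q55; field;
  rewrite !natE.
Qed.

End XFreeField.

Lemma x_free_field_coef0 v : regular_in_charts 0 v ->
  (forall k j, (k < 5)%N -> (0 < j <= 5)%N -> v k 1 j = 0) ->
  (forall k, (0 < k < 5)%N -> v k 0 1 = 0) ->
  forall k i j, (k < 5)%N -> (i <= j <= 5)%N -> (0 < k + j)%N -> v k i j = 0.
Proof.
move=> reg_v x_free x_free1.
have [x01 q55 z00 cwE] := cw_form reg_v x_free x_free1.
have [q04 y00 czE] := cz_form reg_v x_free x_free1.
have [_ _ q02 cyE] := cy_form reg_v x_free x_free1.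
have [_ _ cxE] := cx_form reg_v x_free x_free1.
have cqE := cq_form reg_v x_free x_free1.
have vE k : (k < 5)%N -> forall x y z w q,
    quad (v k) x y z w q = if k == 0%N then v 0%N 0%N 0%N else 0.
  case: k => [|[|[|[|[|//]]]]] _ x y z w q.
  - by rewrite cxE x01 q55 q02 q04 q55; field; rewrite !natE.
  - by rewrite cyE x01 q55 q04 y00; ring.
  - by rewrite czE x01 q55 z00; ring.
  - by rewrite cwE.
  - by rewrite cqE x01 q55 q04; ring.
move=> k i j lt_k5 le_ij; case: (posnP j) => [j0|j0 _].
  rewrite j0 addn0; move: le_ij; rewrite j0 leqn0 => /andP[/eqP-> _] k0.
  have := vE _ lt_k5 0 0 0 0 0; rewrite (gtn_eqF k0) => <-.
  by rewrite /quad; ring.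
exact: quad_cst_coef0 (vE _ lt_k5) _ _ le_ij j0.
Qed.

Lemma regular_field_coef0 v : regular_in_charts 0 v ->
  forall k i j, (k < 5)%N -> (i <= j <= 5)%N -> (0 < k + j)%N -> v k i j = 0.
Proof.
move=> reg_v; have reg_dv := regular_in_charts_xdiff reg_v.
have v11 k : (0 < k < 5)%N -> v k 1%N 1%N = 0.
  case/andP=> k0 lt_k5.
  have : xdiff (xdiff (v k)) 0 0 = 0.
    apply: (x_free_field_coef0 (regular_in_charts_xdiff reg_dv)) => //; last by rewrite addn0.
    by move=> k' _; rewrite /= mul0rn.
  by rewrite /= addr0 => /(eq_by_multiple 2%:R^-1); apply; field; rewrite natE.
have dv0 k j : (k < 5)%N -> (j <= 5)%N -> (0 < k + j)%N -> xdiff (v k) 0 j = 0.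
  move=> lt_k5 le_j5; apply: (x_free_field_coef0 reg_dv) => // k' /v11 /=.
  by move=> ->; rewrite mul0rn.
have v1 k j : (k < 5)%N -> (0 < j <= 5)%N -> v k 1%N j = 0.
  move=> lt_k5; case: j => [|[|j]] // le_j5; last by rewrite -(dv0 k j.+2) // addnS.
  have : xdiff (v k) 0 1 = 0 by rewrite dv0 // addn1.
  by move=> /(eq_by_multiple 2%:R^-1); apply; rewrite /=; field; rewrite natE.
apply: x_free_field_coef0 => // k /andP[k0 lt_k5].
by rewrite -(dv0 k 0%N) ?addn0 //= v1 ?addr0.
Qed.

Definition normal_form_coef (k i j : nat) : E :=
  match k, i, j with
  | 0%N, 0%N, 2%N => 1
  | 1%N, 0%N, 3%N => 1
  | 2%N, 0%N, 0%N => t / 4%:R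
  | 2%N, 0%N, 4%N => 1
  | 2%N, 2%N, 2%N => - 6%:R
  | 3%N, 0%N, 0%N => (2%:R * a - 1) / 4%:R
  | 3%N, 4%N, 5%N => 1
  | 4%N, 0%N, 2%N => - 4%:R
  | 4%N, 5%N, 5%N => - 2%:R^-1
  | _, _, _ => 0
  end.

Lemma normal_form_chart1 x y z i :
  regular (chart1_velocity a (fun k => quad_chart1 (normal_form_coef k) x y z) i).
Proof.
pose p : {poly E} := [:: y%:P; z%:P;
  (t / 4%:R - 6%:R * y ^+ 2)%:P - (a - 2%:R^-1) *: 'X;
  (- 4%:R * (a - 2%:R^-1) * y)%:P; 2%:R^-1%:P + (4%:R * y) *: 'X^2]`_i.
exists p => s s0; rewrite {}/p /chart1_velocity /quad_chart1 /quad_seq /quad.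
case: i => [|[|[|[|[|i]]]]] /=; rewrite ?nth_nil ?hornerE /=; by field; rewrite ?s0 ?natE.
Qed.

Lemma normal_form_chart2 x y z i :
  regular (chart2_velocity a 1 y z (fun k => quad_chart2 (normal_form_coef k) x y z) i).
Proof.
pose p : {poly E} := [:: (- y)%:P; z%:P;
  (6%:R * y ^+ 2 - t / 4%:R)%:P + (2%:R^-1 + a) *: 'X;
  (4%:R * (2%:R^-1 + a) * y)%:P; (- 2%:R^-1)%:P + (4%:R * y) *: 'X^2]`_i.
exists p => s s0; rewrite {}/p /chart2_velocity /quad_chart2 /quad_seq /quad.
case: i => [|[|[|[|[|i]]]]] /=; rewrite ?nth_nil ?hornerE /=; by field; rewrite ?s0 ?natE.
Qed.

Lemma regular_normal_form v : regular_in_charts 1 v ->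
  forall k i j, (k < 5)%N -> (i <= j <= 5)%N -> (0 < k + j)%N -> v k i j = normal_form_coef k i j.
Proof.
have reg_nf : regular_in_charts 1 normal_form_coef.
  by move=> x y z i _; split; [exact: normal_form_chart1 | exact: normal_form_chart2].
move=> /regular_in_chartsB /(_ reg_nf); rewrite subrr => /regular_field_coef0 coef0.
by move=> k i j lt_k5 le_ij kj0; apply/subr0_eq/coef0.
Qed.

End QuadraticFields.

Lemma mquad_normal_form (E : fieldType) (t a : E) :
  [/\ mquad (normal_form_coef t a 0) = 'X_(inord 1),
      mquad (normal_form_coef t a 1) = 'X_(inord 2),
      mquad (normal_form_coef t a 2) =
        - 6%:R * 'X_(inord 1) ^+ 2 + 'X_(inord 3) + (t / 4%:R)%:MP,
      mquad (normal_form_coef t a 3) =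
        'X_(inord 3) * 'X_(inord 4) + ((2%:R * a - 1) / 4%:R)%:MP
    & mquad (normal_form_coef t a 4) =
        - (2%:R^-1 : E)%:MP * 'X_(inord 4) ^+ 2 - 4%:R * 'X_(inord 1)].
Proof.
by split; rewrite /mquad /quad /= ?mpolyCN ?mpolyC0 ?mpolyC1 ?mpolyC_nat; ring.
Qed.

(** * The system *)

Section ChartJets.
Variables (R : idomainType) (E : fieldType) (phi : {rmorphism R -> E}).
Variable D : {fraction R} -> {fraction R}.
Hypothesis derD : derivation D.
Hypothesis pchar_E : [pchar E] =i pred0.
Let natE := natr_neq0 pchar_E.
Local Notation jet := (jet phi D).

Lemma jet_natV k : jet (k.+1%:R^-1) (k.+1%:R^-1) 0.
Proof.
by apply: (jet_eq (jetV derD (natE k) (jet_nat phi derD k.+1))); rewrite // oppr0 mul0r.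
Qed.

Local Ltac jets := do ?[eassumption | exact: jet_natV | exact: jet_nat | exact: jet1
  | apply: (jetD derD) | apply: (jetM derD) | apply: (jetN derD) | apply: (jetX derD)].

Variables (w q t a : {fraction R}) (s t0 a0 w1 q1 : E).
Hypotheses (s_neq0 : s != 0) (jet_t : jet t t0 1) (jet_a : jet a a0 0).
Hypothesis jet_q : jet q s^-1 q1.

Lemma jet_invq : jet q^-1 s (- q1 * s ^+ 2).
Proof.
apply: (jet_eq (jetV derD _ jet_q)); first by rewrite invr_eq0.
  by rewrite invrK.
by rewrite exprVn invrK.
Qed.

Lemma jet_chart1_w : jet w (- (a0 - 2%:R^-1) * s) w1 ->
  jet (- (w * q + 2%:R^-1 * (2%:R * a - 1)) * q) 0 (- w1 / s ^+ 2 + (a0 - 2%:R^-1) * q1).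
Proof.
move=> jet_w; apply: jet_eq; first by jets.
  by field; rewrite s_neq0 !natE.
by field; rewrite s_neq0 !natE.
Qed.

Variables (x y z : {fraction R}) (x0 y0 z0 x1 y1 z1 : E).
Hypothesis jet_y : jet y (y0 - s^-1 ^+ 2 / 4%:R) y1.
Hypothesis jet_z : jet z (z0 + 2%:R * y0 * s^-1 - s^-1 ^+ 3 / 4%:R) z1.

Lemma jet_chart2_x : jet x (x0 - s^-1 / 2%:R) x1 ->
  jet (x + q / 2%:R) x0 (x1 + q1 / 2%:R).
Proof. by move=> jet_x; apply: jet_eq; [by jets | ring | ring]. Qed.

Lemma jet_chart2_y : jet (y + q ^+ 2 / 4%:R) y0 (y1 + s^-1 / 2%:R * q1).
Proof.
apply: jet_eq; first by jets.
  by ring.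
by field; rewrite s_neq0 !natE.
Qed.

Lemma jet_chart2_z :
  jet (z - 4%:R^-1 * q * (q ^+ 2 + 8%:R * y)) z0
    (z1 - 2%:R / s * y1 - (s ^- 2 / 4%:R + 2%:R * y0) * q1).
Proof.
apply: jet_eq; first by jets.
  by field; rewrite s_neq0 !natE.
by field; rewrite s_neq0 !natE.
Qed.

Lemma jet_chart2_w :
  jet w (- t0 / 2%:R + 4%:R * y0 ^+ 2 + y0 * s^-1 ^+ 2 + 2%:R * z0 * s^-1
         + (2%:R^-1 + a0) * s) w1 ->
  jet (- ((w + t / 2%:R - 4%:R * y ^+ 2 + q * (y * q - 2%:R * z)) * q - 2%:R^-1 - a) * q) 0
    (- (w1 + 1 / 2%:R - (8%:R * y0 - 3%:R / s ^+ 2) * y1 - 2%:R / s * z1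
        - (2%:R * z0 + 2%:R * y0 / s) * q1) / s ^+ 2 - (2%:R^-1 + a0) * q1).
Proof.
move=> jet_w; apply: jet_eq; first by jets.
  by field; rewrite s_neq0 !natE.
by field; rewrite s_neq0 !natE.
Qed.

End ChartJets.

Lemma deriv_derivation (R : comNzRingType) : derivation (@deriv R).
Proof. by split; [exact: derivD | exact: derivM]. Qed.

Lemma derK_derivation : derivation derK.
Proof. exact: fderiv_derivation (deriv_derivation C). Qed.

HB.instance Definition _ :=
  GRing.isZmodMorphism.Build K K derK (derivationB derK_derivation).

Lemma derK_tK : derK tK = 1.
Proof. by rewrite [LHS](fderiv_tofrac (deriv_derivation C)) derivX tofrac1. Qed.

Lemma derK_cK c : derK (cK c) = 0.
Proof. by rewrite [LHS](fderiv_tofrac (deriv_derivation C)) derivC tofrac0. Qed.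

Lemma pchar_K : [pchar K] =i pred0.
Proof.
apply/GRing.pcharf0P => n; rewrite -[1 : K]/(1%:F) -tofracMn tofrac_eq0.
by rewrite -polyC_natr polyC_eq0 (@Num.Theory.pnatr_eq0 (complex Rdefinitions.R)).
Qed.

Section System.
Variable f : 'I_5 -> MP.

Lemma mpD_derivation : derivation (mpD f).
Proof. exact: vector_field_derivation derK_derivation f. Qed.

Lemma derL_derivation : derivation (derL f).
Proof. exact: fderiv_derivation mpD_derivation. Qed.

Lemma jet_mpoly v (P : MP) : jet (meval v) (derL f) P%:F P.@[v] (mpD f P).@[v].
Proof.
split; first exact: specializes_tofrac.
rewrite [derL f _](fderiv_tofrac mpD_derivation); exact: specializes_tofrac.
Qed.

Lemma jet_varL (l : seq K) k : (k < 5)%N ->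
  jet (meval (point l)) (derL f) (varL k) l`_k (f (inord k)).@[point l].
Proof.
move=> k5; have := jet_mpoly (point l) (var k).
by rewrite [mpD f _](vector_fieldX derK_derivation) mevalXU /point inordK.
Qed.

Lemma jet_cL v c : jet (meval v) (derL f) (cL c) c (derK c).
Proof. by have := jet_mpoly v c%:MP; rewrite [mpD f _](vector_fieldC derK f) !mevalC. Qed.

Variable alpha2 : C.
Let a := cK alpha2.

Definition chart_curve (x y z : K) (i : 'I_5) : {poly K} := [:: x%:P; y%:P; z%:P; 0; 'X]`_i.

Lemma r1_regular x y z (i : 'I_5) : polynomial_in_coords f (r1 alpha2) ->
  regular (chart1_velocity a (fun k s => (f (inord k)).@[point (chart1_coords a x y z s)]) i).
Proof.
move=> f_poly; apply: (regular_jet (v := fun s => point (chart1_coords a x y z s))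
  (p := chart_curve x y z) (d := fun i => chart1_velocity a _ i) f_poly) => s {}i s0.
have jet_v := @jet_varL (chart1_coords a x y z s).
have jet_a : jet (meval (point (chart1_coords a x y z s))) (derL f) (cL a) a 0.
  by rewrite -(derK_cK alpha2); exact: jet_cL.
rewrite /chart_curve /chart1_velocity.
case: i => [[|[|[|[|[|//]]]]] lt_i5] /=; rewrite ?hornerC ?horner0 ?hornerX.
- exact: (jet_v 0%N).
- exact: (jet_v 1%N).
- exact: (jet_v 2%N).
- exact: (jet_chart1_w derL_derivation pchar_K s0 jet_a (jet_v 4%N isT) (jet_v 3%N isT)).
- exact: (jet_invq derL_derivation s0 (jet_v 4%N isT)).
Qed.

Lemma r2_regular x y z (i : 'I_5) : polynomial_in_coords f (r2 alpha2) ->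
  regular (chart2_velocity a 1 y z
    (fun k s => (f (inord k)).@[point (chart2_coords tK a x y z s)]) i).
Proof.
move=> f_poly; apply: (regular_jet (v := fun s => point (chart2_coords tK a x y z s))
  (p := chart_curve x y z) (d := fun i => chart2_velocity a 1 y z _ i) f_poly) => s {}i s0.
have jet_v := @jet_varL (chart2_coords tK a x y z s).
have [jx jy jz] := And3 (jet_v 0 isT) (jet_v 1 isT) (jet_v 2 isT).
have [jw jq] := conj (jet_v 3 isT) (jet_v 4 isT).
have jet_a : jet (meval (point (chart2_coords tK a x y z s))) (derL f) (cL a) a 0.
  by rewrite -(derK_cK alpha2); exact: jet_cL.
have jet_t : jet (meval (point (chart2_coords tK a x y z s))) (derL f) (cL tK) tK 1.
  by have := jet_cL (point (chart2_coords tK a x y z s)) tK; rewrite derK_tK.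
rewrite /chart_curve /chart2_velocity.
case: i => [[|[|[|[|[|//]]]]] lt_i5] /=; rewrite ?hornerC ?horner0 ?hornerX.
- exact: (jet_chart2_x derL_derivation pchar_K jq jx).
- exact: (jet_chart2_y derL_derivation pchar_K s0 jq jy).
- exact: (jet_chart2_z derL_derivation pchar_K s0 jq jy jz).
- exact: (jet_chart2_w derL_derivation pchar_K s0 jet_t jet_a jq jy jz jw).
- exact: (jet_invq derL_derivation s0 jq).
Qed.

Lemma regular_in_charts_mquad (c : 'I_5 -> nat -> nat -> K) :
  (forall i, f i = mquad (c i)) ->
  polynomial_in_coords f (r1 alpha2) -> polynomial_in_coords f (r2 alpha2) ->
  regular_in_charts tK a 1 (fun k => c (inord k)).
Proof.
move=> fE poly1 poly2 x y z i lt_i5; split.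
  apply: eq_regular (r1_regular x y z (Ordinal lt_i5) poly1) _ => s _.
  by apply: eq_chart1_velocity => k; rewrite fE meval_mquad.
apply: eq_regular (r2_regular x y z (Ordinal lt_i5) poly2) _ => s _.
by apply: eq_chart2_velocity => k; rewrite fE meval_mquad.
Qed.

End System.

Unset Implicit Arguments.

Theorem theorem9p3 (alpha2 : C) (f : 'I_5 -> MP) :
  (* (A1) the system has degree 2 in x,y,z,w,q *)
  (forall i : 'I_5, (msize (f i) <= 3)%N) ->
  (exists i : 'I_5, msize (f i) = 3%N) ->
  (* (A2) polynomiality in the coordinate systems r1, r2, r3 *)
  polynomial_in_coords f (r1 alpha2) ->
  polynomial_in_coords f (r2 alpha2) ->
  polynomial_in_coords f (r3 alpha2) ->
  exists g : K,
    [/\ f (inord 0) = var 1 + g%:MP,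
        f (inord 1) = var 2,
        f (inord 2) = - 6%:R * var 1 ^+ 2 + var 3 + (tK / 4%:R)%:MP,
        f (inord 3) = var 3 * var 4 + ((2%:R * cK alpha2 - 1) / 4%:R)%:MP
      & f (inord 4) = - (2%:R^-1 : K)%:MP * var 4 ^+ 2 - 4%:R * var 1].
Proof.
move=> deg_f _ poly1 poly2 _.
have [c fE] := fin_all_exists (fun i => mquad_exists (deg_f i)).
have cE := regular_normal_form pchar_K (regular_in_charts_mquad fE poly1 poly2).
have f_eq k : (k < 5)%N -> f (inord k) = mquad (normal_form_coef tK (cK alpha2) k)
    + (c (inord k) 0%N 0%N - normal_form_coef tK (cK alpha2) k 0 0)%:MP.
  move=> lt_k5; rewrite fE; apply: eq_mquad_cst => i j le_ij j0.
  by rewrite cE // ltn_addl.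
have f_normal_form k : (0 < k < 5)%N -> f (inord k) = mquad (normal_form_coef tK (cK alpha2) k).
  by case/andP=> k0 lt_k5; rewrite f_eq // cE ?addn0 // subrr mpolyC0 addr0.
have [p0 p1 p2 p3 p4] := mquad_normal_form tK (cK alpha2).
exists (c (inord 0) 0%N 0%N); split; first by rewrite f_eq // p0 /= subr0.
all: by rewrite f_normal_form.
Qed.
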